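(* Consider the closed-loop system consisting of the state equation $\dot x(t)=f(x(t),u(t))$, $x(0)=x_0$, the output equation $y(t)=h(x(t))$, and the controller equation $$\dot u(t)=\Big(\frac{\partial g}{\partial u}(x(t),u(t))\Big)^{-1}\Big(r(t+T)-\hat y(t+T)+\dot r(t+T)-\frac{\partial g}{\partial x}(x(t),u(t))\,f(x(t),u(t))+\mathcal E_2(t)\Big),$$ where $\hat y(t+T)=g(x(t),u(t))$ and $\mathcal E_2(t)\in\mathbb R^m$ is an additive error. Let $\eta_2:=\limsup_{t\to\infty}\|\mathcal E_2(t)\|$. If the trajectory of the closed-loop system is nonsingular, then $$\limsup_{t\to\infty}\|r(t)-\hat y(t)\|\le\eta_2.$$
   Context: Setting: $x(t)\in\mathbb R^n$ is the state, $u(t)\in\mathbb R^m$ the control input, $y(t)\in\mathbb R^m$ the output, $r(t)\in\mathbb R^m$ the reference signal, and $T>0$ a fixed lookahead time. Standing assumptions. (1) $f:\mathbb R^n\times\mathbb R^m\to\mathbb R^n$ is continuously differentiable, and for every compact set $\Gamma\subset\mathbb R^m$ there is $K>0$ such that $\|f(x,u)\|\le K(\|x\|+1)$ for all $x\in\mathbb R^n$, $u\in\Gamma$; $h:\mathbb R^n\to\mathbb R^m$ is continuously differentiable. (2) $g:\mathbb R^n\times\mathbb R^m\to\mathbb R^m$ (the output predictor) is continuously differentiable in $(x,u)$. (3) $r(\cdot)$ is continuous and piecewise differentiable; equations containing $\dot r(t+T)$ are understood at those $t$ where this derivative exists. Notation. The predicted output is $\hat y(t+T):=g(x(t),u(t))$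 for $t\ge0$, i.e. $\hat y(t)=g(x(t-T),u(t-T))$ for $t\ge T$. $\|\cdot\|$ is the Euclidean norm. A closed-loop trajectory (defined for all $t\ge 0$) is called nonsingular if the partial Jacobian $\frac{\partial g}{\partial u}(x(t),u(t))$ is nonsingular for every $t\ge0$. *)

(* Defs.v *)
From HB Require Import structures.
From mathcomp Require Import all_boot all_order all_algebra.
From mathcomp Require Import all_classical all_reals all_analysis.

Set Implicit Arguments.
Unset Strict Implicit.
Unset Printing Implicit Defensive.

Import Order.TTheory GRing.Theory Num.Theory.
Import numFieldNormedType.Exports.

Local Open Scope classical_set_scope.
Local Open Scope ring_scope.

(* R^k is 'rV[R]_k. The library norm on 'rV[R]_k is the sup norm (it is used
   only for the topology); this is the Euclidean one. *)
Definition enorm (R : realType) (k : nat) (v : 'rV[R]_k) : R :=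
  Num.sqrt (\sum_(i < k) v ord0 i ^+ 2).

Definition limsup_pinfty (R : realType) (w : R -> R) : \bar R :=
  limf_esup (fun t => (w t)%:E) (pinfty_nbhs R).

(* V is meant to be finite-dimensional, so that continuity of p |-> 'd F p v for
   each fixed v is continuity of p |-> 'd F p. *)
Definition continuously_differentiable (R : realType) (V W : normedModType R)
    (F : V -> W) : Prop :=
  (forall p, differentiable F p) /\ (forall v, continuous (fun p => 'd F p v)).

Definition linear_growth (R : realType) (n m : nat)
    (f : 'rV[R]_n * 'rV[R]_m -> 'rV[R]_n) : Prop :=
  forall Gamma : set 'rV[R]_m, compact Gamma ->
    exists2 K : R, 0 < K &
      forall (x : 'rV[R]_n) (u : 'rV[R]_m), Gamma u ->
        enorm (f (x, u)) <= K * (enorm x + 1).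

(* Library Jacobians act on row vectors from the right, v *m 'J F p = 'd F p v,
   so these are the transposes of the matrices for column vectors. *)
Definition jacobian_x (R : realType) (n m k : nat)
    (g : 'rV[R]_n * 'rV[R]_m -> 'rV[R]_k) (x : 'rV[R]_n) (u : 'rV[R]_m) :
    'M[R]_(n, k) :=
  jacobian (fun a : 'rV[R]_n => g (a, u)) x.

Definition jacobian_u (R : realType) (n m k : nat)
    (g : 'rV[R]_n * 'rV[R]_m -> 'rV[R]_k) (x : 'rV[R]_n) (u : 'rV[R]_m) :
    'M[R]_(m, k) :=
  jacobian (fun b : 'rV[R]_m => g (x, b)) u.

(* Two-sided derivative for t > 0, right derivative for t = 0. *)
Definition is_derive_ge0 (R : realType) (V : normedModType R) (w : R -> V)
    (t : R) (dw : V) : Prop :=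
  h^-1 *: (w (h + t) - w t) @[h --> within [set h | 0 <= h + t] 0^'] --> dw.

Definition continuous_ge0 (R : realType) (V : normedModType R) (w : R -> V) :
    Prop :=
  {within `[0, +oo[%classic, continuous w}.

Definition piecewise_differentiable (R : realType) (V : normedModType R)
    (w : R -> V) : Prop :=
  forall b : R, finite_set [set t | 0 < t < b /\ ~ derivable w t 1].

(* g (x (t - T), u (t - T)) is the predicted output for t >= T only; the values
   at t < T are irrelevant. *)
Definition predicted_output (R : realType) (n m : nat) (T : R)
    (g : 'rV[R]_n * 'rV[R]_m -> 'rV[R]_m)
    (x : R -> 'rV[R]_n) (u : R -> 'rV[R]_m) (t : R) : 'rV[R]_m :=
  g (x (t - T), u (t - T)).

(* The controller equation is required at the times where the derivative of r at
   t + T exists; at the others u is only required to be continuous. *)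
Record closed_loop_trajectory (R : realType) (n m : nat) (T : R)
    (f : 'rV[R]_n * 'rV[R]_m -> 'rV[R]_n)
    (h : 'rV[R]_n -> 'rV[R]_m)
    (g : 'rV[R]_n * 'rV[R]_m -> 'rV[R]_m)
    (r E2 : R -> 'rV[R]_m) (x0 : 'rV[R]_n)
    (x : R -> 'rV[R]_n) (u y : R -> 'rV[R]_m) : Prop := ClosedLoopTrajectory {
  state_init : x 0 = x0 ;
  state_eq : forall t : R, 0 <= t -> is_derive_ge0 x t (f (x t, u t)) ;
  output_eq : forall t : R, 0 <= t -> y t = h (x t) ;
  control_continuous : continuous_ge0 u ;
  control_eq : forall t : R, 0 <= t -> derivable r (t + T) 1 ->
    is_derive_ge0 u t
      ((r (t + T) - g (x t, u t) + derive1 r (t + T)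
        - f (x t, u t) *m jacobian_x g (x t) (u t) + E2 t)
       *m invmx (jacobian_u g (x t) (u t))) }.

Definition nonsingular_trajectory (R : realType) (n m : nat)
    (g : 'rV[R]_n * 'rV[R]_m -> 'rV[R]_m)
    (x : R -> 'rV[R]_n) (u : R -> 'rV[R]_m) : Prop :=
  forall t : R, 0 <= t -> jacobian_u g (x t) (u t) \in unitmx.

(* Main.v *)
Require Import Defs.
From HB Require Import structures.
From mathcomp Require Import all_boot all_order all_algebra.
From mathcomp Require Import all_classical all_reals all_analysis.
From mathcomp Require Import ring lra.
Import Order.TTheory GRing.Theory Num.Theory.
Import numFieldNormedType.Exports.
Local Open Scope classical_set_scope.
Local Open Scope ring_scope.

(** Along the trajectory the tracking error [e t = r (t + T) - g (x t, u t)]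
    satisfies [e' = - e - E2] wherever [r] is differentiable: the controller is
    designed to cancel everything else in the chain rule for [g (x t, u t)].
    Hence [V = |e|^2] satisfies
    [V' = - 2 V - 2 <e, E2> <= - V + |E2|^2 <= - V + c^2]
    as soon as [|E2| <= c], and [V] being continuous, the finitely many bad times
    in each bounded interval do not prevent [(V t - c^2) exp t] from decreasing.
    So [V t <= c^2 + K exp (- t)] for every [c] above the upper limit of [|E2|]. *)

(** * Differential inequalities and upper limits at infinity *)

Section real_functions.
Context {R : realType}.
Implicit Types (V W : R -> R) (a b c t : R).

(** Induction on [s]: an exceptional point inside the interval splits it, and continuity there lets
    the two inequalities chain through [W p]; a point outside is dropped. *)
Lemma ler0_derive_off_seq_le W a b (s : seq R) : a <= b ->
  (forall t, a <= t <= b -> {for t, continuous W}) ->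
  (forall t, a < t < b -> t \notin s ->
    exists2 dW, is_derive t 1 W dW & dW <= 0) ->
  W b <= W a.
Proof.
elim: s a b => [|p s IHs] a b ab cW dW.
  apply: (@ler0_derive1_le_cc _ W a b) => //.
  - by move=> t; rewrite in_itv/= => /dW /(_ isT)[d] [].
  - move=> t; rewrite in_itv/= => /dW /(_ isT)[d ? ?].
    by rewrite derive1E derive_val.
  - apply: continuous_in_subspaceT => t; rewrite inE/= in_itv/=; exact: cW.
  - by rewrite in_itv/= lexx ab.
  - by rewrite in_itv/= lexx ab.
have [/andP[ap pb]|pab] := boolP (a < p < b).
  apply: (@le_trans _ _ (W p)); apply: IHs.
  - exact: ltW.
  - by move=> t /andP[pt tb]; apply: cW; rewrite tb andbT; lra.
  - move=> t /andP[pt tb] ts; apply: dW; first by rewrite tb andbT; lra.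
    by rewrite inE negb_or ts andbT gt_eqF.
  - exact: ltW.
  - by move=> t /andP[pt tb]; apply: cW; rewrite pt/=; lra.
  - move=> t /andP[pt tb] ts; apply: dW; first by rewrite pt/=; lra.
    by rewrite inE negb_or ts andbT lt_eqF.
apply: IHs => // t tab ts; apply: dW => //.
by rewrite inE negb_or ts andbT; apply: contraNneq pab => <-.
Qed.

Lemma linear_differential_ineq V c a b : a <= b ->
  (forall t, a <= t <= b -> {for t, continuous V}) ->
  finite_set [set t | a < t < b /\
    ~ exists2 dV, is_derive t 1 V dV & dV <= c - V t] ->
  V b <= c + (V a - c) * expR (a - b).
Proof.
move=> ab cV /finite_seqP[s sE].
pose W := (V - cst c) * expR.
suff: W b <= W a.
  rewrite /W/= expRB mulrA -lerBlDl ler_pdivlMr ?expR_gt0//.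
apply: (@ler0_derive_off_seq_le W a b s) => // t tab.
  apply: continuousM; last exact: continuous_expR.
  by apply: continuousB; [exact: cV|exact: cst_continuous].
move=> ts; have [dV dVt dVle] : exists2 dV, is_derive t 1 V dV & dV <= c - V t.
  apply: contrapT => nd; move/negP: ts; apply.
  by have : [set` s] t by rewrite -sE; split.
(* Product rule with integrating factor [expR]; factoring it out leaves [dV + V t - c], which is
   nonpositive by [dVle]. *)
exists ((V t - c) *: expR t + expR t *: (dV - 0)); first exact: is_deriveM.
rewrite subr0 /GRing.scale/= mulrC -mulrDr pmulr_rle0 ?expR_gt0//; lra.
Qed.

(** The upper limit is an infimum of suprema over neighbourhoods of [+oo], so one of these suprema
    is already below [c]. *)
Lemma limsup_pinfty_lt W c : (limsup_pinfty W < c%:E)%E ->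
  \forall t \near +oo, W t < c.
Proof.
move=> /ereal_inf_lt[_ [A A_oo <-] Ac]; apply: filterS A_oo => t At.
rewrite -lte_fin; apply: le_lt_trans Ac.
by apply: ereal_sup_ubound; exists t.
Qed.

Lemma limsup_pinfty_le W c : (\forall t \near +oo, W t <= c) ->
  (limsup_pinfty W <= c%:E)%E.
Proof.
move=> Wc; apply: ge_ereal_inf; eexists; first by exists [set t | W t <= c].
by apply: ge_ereal_sup => _ [t /= Wt <-]; rewrite lee_fin.
Qed.

End real_functions.

(** * Derivatives in time and the chain rule along a trajectory *)

Section time_derivatives.
Context {R : realType}.
Implicit Types (V : normedModType R) (t : R).

(** At [t > 0] the restriction [0 <= h + t] is void once [|h| < t], so the limit is the ordinary
    two-sided one. *)
Lemma is_derive_ge0_gt0 V (w : R -> V) t dw : 0 < t ->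
  is_derive_ge0 w t dw -> is_derive t 1 w dw.
Proof.
move=> t0 wt.
have {}wt : h^-1 *: (w (h *: 1 + t) - w t) @[h --> 0^'] --> dw.
  under eq_fun do rewrite [_ *: 1]mulr1.
  apply: cvg_trans wt; apply: cvg_app => A A0.
  have {}A0 : \forall h \near (0 : R)^', 0 <= h + t -> A h by exact: A0.
  have : \forall h \near (0:R)^', 0 <= h + t.
    near=> h.
    have : `|h| < t by near: h; exact: dnbhs0_lt.
    by rewrite ltr_norml => /andP[? ?]; lra.
  by apply: filterS2 A0 => h; exact.
by apply: DeriveDef; [apply/cvg_ex; exists dw|exact: cvg_lim].
Unshelve. all: by end_near. Qed.

Lemma continuous_ge0_gt0 V (w : R -> V) t : 0 < t ->
  continuous_ge0 w -> {for t, continuous w}.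
Proof.
move=> t0 cw; have t02 : (0 : R) < t + 1 by lra.
apply: (@within_continuous_continuous _ _ _ 0 (t + 1)) => //.
  apply: continuous_subspaceW cw => s /=; rewrite !in_itv/= andbT.
  by case/andP.
by rewrite in_itv/= t0; lra.
Qed.

Lemma is_derive_partial (n m k : nat) (g : 'rV[R]_n * 'rV[R]_m -> 'rV[R]_k)
    (x : R -> 'rV[R]_n) (u : R -> 'rV[R]_m) t dx du :
  differentiable g (x t, u t) -> is_derive t 1 x dx -> is_derive t 1 u du ->
  is_derive t 1 (fun s => g (x s, u s))
    (dx *m jacobian_x g (x t) (u t) + du *m jacobian_u g (x t) (u t)).
Proof.
move=> dg xt ut.
have dxt : differentiable x t by apply/derivable1_diffP.
have dut : differentiable u t by apply/derivable1_diffP.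
have dxut : differentiable (fun s => (x s, u s)) t by exact: differentiable_pair.
have dgt : differentiable (g \o (fun s => (x s, u s))) t.
  exact: differentiable_comp.
apply: DeriveDef; first exact/derivable1_diffP.
rewrite deriveE// diff_comp//= diff_pair//= -!deriveE// !derive_val.
rewrite !mul_rV_lin1.
(* Each partial Jacobian comes from [g] composed with an affine inclusion into the product; the two
   pieces add up by linearity, as [(dx, du) = (dx, 0) + (0, du)]. *)
have [px dpx] : is_diff (x t) (fun a => (a, u t)) (fun a => (a, 0)).
  exact: (@is_diff_pair _ _ _ _ id id (cst (u t)) 0).
have [pu dpu] : is_diff (u t) (fun b => (x t, b)) (fun b => (0, b)).
  exact: (@is_diff_pair _ _ _ _ (cst (x t)) 0 id id).
have -> : 'd (fun a => g (a, u t)) (x t) dx = 'd g (x t, u t) (dx, 0).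
  by rewrite (@diff_comp _ _ _ _ (fun a => (a, u t)) g)//= dpx.
have -> : 'd (fun b => g (x t, b)) (u t) du = 'd g (x t, u t) (0, du).
  by rewrite (@diff_comp _ _ _ _ (fun b => (x t, b)) g)//= dpu.
rewrite -linearD deriveE//; congr ('d g _ _).
by congr (_, _) => /=; rewrite ?addr0 ?add0r.
Qed.

Lemma is_derive_addr V (w : R -> V) t c : derivable w (t + c) 1 ->
  is_derive t 1 (fun s => w (s + c)) (derive1 w (t + c)).
Proof.
have E : (fun h : R => h^-1 *: (((fun s => w (s + c)) \o shift t) (h *: 1)
            - w (t + c))) =
         (fun h => h^-1 *: ((w \o shift (t + c)) (h *: 1) - w (t + c))).
  by apply/funext => h /=; rewrite addrA.
by move=> wt; apply: DeriveDef; rewrite ?derive1E /derivable /derive E.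
Qed.

Lemma is_derive_coord (m n : nat) (M : R -> 'M[R]_(m, n)) t dM i j :
  is_derive t 1 M dM -> is_derive t 1 (fun s => M s i j) (dM i j).
Proof.
move=> Mt; have Mij := (derivable_mxP M t 1).1 (@ex_derive _ _ _ _ _ _ _ Mt) i j.
apply: DeriveDef => //.
by rewrite -[dM](@derive_val _ _ _ _ _ _ _ Mt) derive_mx ?mxE//; case: Mt.
Qed.

End time_derivatives.

(** * The squared Euclidean norm as a Lyapunov function *)

Section euclidean_norm.
Context {R : realType} {k : nat}.
Implicit Types (v : 'rV[R]_k) (e : R -> 'rV[R]_k).

Lemma enorm_ge0 v : 0 <= enorm v. Proof. exact: sqrtr_ge0. Qed.

Lemma sqr_enorm v : enorm v ^+ 2 = \sum_(i < k) v ord0 i ^+ 2.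
Proof. by rewrite sqr_sqrtr// sumr_ge0// => i _; exact: sqr_ge0. Qed.

Lemma sqr_enorm_sum e :
  (fun t => enorm (e t) ^+ 2) = \sum_(i < k) (fun t => e t ord0 i) ^+ 2.
Proof. by apply/funext => t; rewrite sqr_enorm fct_sumE. Qed.

Lemma continuous_sqr_enorm e (t : R) : {for t, continuous e} ->
  {for t, continuous (fun t => enorm (e t) ^+ 2)}.
Proof.
move=> ct; rewrite /prop_for /continuous_at sqr_enorm.
under eq_fun do rewrite sqr_enorm.
apply: cvg_big => [|i _]; first exact: add_continuous.
 rewrite expr2; under eq_fun do rewrite expr2.
have ei : e s ord0 i @[s --> t] --> e t ord0 i.
  exact: (cvg_comp e (fun M : 'rV[R]_k => M ord0 i) ct
    (@coord_continuous R 1 k ord0 i (e t))).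
exact: cvgM.
Qed.

Lemma is_derive_sqr_enorm e (t : R) de : is_derive t 1 e de ->
  is_derive t 1 (fun t => enorm (e t) ^+ 2)
    (\sum_(i < k) (2 * e t ord0 i) * de ord0 i).
Proof.
move=> et; rewrite sqr_enorm_sum; apply: is_derive_sum => i.
have ei : is_derive t 1 (fun s => e s ord0 i) (de ord0 i).
  exact: is_derive_coord.
by have := is_deriveX 2 ei; rewrite expr1.
Qed.

(* [- 2 v_i w_i <= v_i ^ 2 + w_i ^ 2] in each coordinate. *)
Lemma sqr_enorm_dissipation v w :
  \sum_(i < k) (2 * v ord0 i) * (- v - w) ord0 i <=
  enorm w ^+ 2 - enorm v ^+ 2.
Proof.
rewrite !sqr_enorm -sumrB; apply: ler_sum => i _; rewrite !mxE.
set a := v _ _; set b := w _ _.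
by have := sqr_ge0 (a + b); rewrite sqrrD; lra.
Qed.

(** The gap [d ^+ 2 - c ^+ 2] absorbs the exponentially decaying transient left by the value of [e]
    at [a]. *)
Lemma enorm_ultimate_bound e (E : R -> 'rV[R]_k) (a c d : R) : 0 <= c -> c < d ->
  (forall t, a <= t -> {for t, continuous e}) ->
  (forall t, a <= t -> enorm (E t) <= c) ->
  (forall b, finite_set
    [set t | a < t < b /\ ~ is_derive t 1 e (- e t - E t)]) ->
  \forall t \near +oo, enorm (e t) <= d.
Proof.
move=> c0 cd ce Ec fin.
pose V t := enorm (e t) ^+ 2.
have Vle t : a <= t -> V t <= c ^+ 2 + (V a - c ^+ 2) * expR (a - t).
  move=> at_; apply: linear_differential_ineq => //.
    by move=> s /andP[as_ _]; apply/continuous_sqr_enorm/ce.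
  (* By contraposition: where [e] has the prescribed derivative, [V] satisfies the inequality with
     constant [c ^+ 2]. *)
  apply: sub_finite_set (fin t) => s /= [ast ns]; split => // es; apply: ns.
  eexists; first exact: is_derive_sqr_enorm es.
  apply: le_trans (sqr_enorm_dissipation _ _) _; rewrite lerD2r.
  rewrite ler_sqr ?nnegrE ?enorm_ge0//; apply: Ec.
  by case/andP: ast => /ltW.
have K0 : (V a - c ^+ 2) * expR a * expR (- t) @[t --> +oo] --> (0 : R).
  by rewrite -[X in _ --> X](mulr0 ((V a - c ^+ 2) * expR a));
    apply: cvgM; [exact: cvg_cst|exact: cvgr_expR].
have dc : 0 < d ^+ 2 - c ^+ 2 by rewrite subr_gt0 ltr_sqr ?nnegrE; lra.
near=> t.
rewrite -ler_sqr ?nnegrE ?enorm_ge0//; last by lra.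
have at_ : a <= t by near: t; exact: nbhs_pinfty_ge (num_real a).
apply: le_trans (Vle t at_) _; rewrite expRD mulrA.
suff : (V a - c ^+ 2) * expR a * expR (- t) < d ^+ 2 - c ^+ 2 by lra.
near: t; exact: (cvgr_lt _ K0).
Unshelve. all: by end_near. Qed.

End euclidean_norm.

(** * The tracking error of the closed loop *)

Theorem proposition3p3 (R : realType) (n m : nat) (T : R)
    (f : 'rV[R]_n * 'rV[R]_m -> 'rV[R]_n)
    (h : 'rV[R]_n -> 'rV[R]_m)
    (g : 'rV[R]_n * 'rV[R]_m -> 'rV[R]_m)
    (r E2 : R -> 'rV[R]_m) (x0 : 'rV[R]_n)
    (x : R -> 'rV[R]_n) (u y : R -> 'rV[R]_m) :
  0 < T ->
  continuously_differentiable f -> linear_growth f ->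
  continuously_differentiable h ->
  continuously_differentiable g ->
  continuous_ge0 r -> piecewise_differentiable r ->
  closed_loop_trajectory T f h g r E2 x0 x u y ->
  nonsingular_trajectory g x u ->
  let eta2 : \bar R := limsup_pinfty (fun t => enorm (E2 t)) in
  (limsup_pinfty (fun t => enorm (r t - predicted_output T g x u t))
    <= eta2)%E.
Proof.
move=> T0 _ _ _ [dg _] cr pr [_ x' _ cu u'] ns /=.
set eta2 := limsup_pinfty (fun t => enorm (E2 t)).
pose e t := r (t + T) - g (x t, u t).
have e_cont t : 0 < t -> {for t, continuous e}.
  move=> t0; apply: continuousB.
    apply: (@continuous_comp _ _ _ (fun s => s + T) r).
      by apply: continuousD; [exact: cvg_id|exact: cvg_cst].
    by apply: continuous_ge0_gt0 => //; rewrite addr_gt0.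
  apply: (@continuous_comp _ _ _ (fun s => (x s, u s)) g).
    have xc : {for t, continuous x}.
      have [+ _] := is_derive_ge0_gt0 _ _ _ _ t0 (x' _ (ltW t0)).
      by move=> /derivable1_diffP/differentiable_continuous.
    (* Continuity of [u] cannot come from [u'], which says nothing where [r] fails to be derivable
       at [t + T]. *)
    have uc : {for t, continuous u} by exact: continuous_ge0_gt0.
    exact: (@cvg_pair _ _ _ (nbhs t) (nbhs (x t)) (nbhs (u t)) _ _ _ x u xc uc).
  exact: differentiable_continuous.
have e' t : 0 < t -> derivable r (t + T) 1 ->
    is_derive t 1 e (- e t - E2 t).
  move=> t0 rt.
  have xt : is_derive t 1 x _ := is_derive_ge0_gt0 _ _ _ _ t0 (x' _ (ltW t0)).
  have ut := is_derive_ge0_gt0 _ _ _ _ t0 (u' _ (ltW t0) rt).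
  have gt := is_derive_partial _ _ _ _ _ _ _ _ _ (dg _) xt ut.
  have rTt := is_derive_addr _ _ _ _ rt.
  apply: is_derive_eq (is_deriveB rTt gt) _.
  (* Nonsingularity cancels [invmx] against [jacobian_u]; then the derivative of [r] and the drift
     term [q] cancel too. *)
  rewrite mulmxKV ?ns ?ltW// /e; set q := f _ *m _.
  by apply/rowP => i; rewrite !mxE; ring.
(* This rules out [-oo] and later makes the bound [s + d / 2] nonnegative. *)
have : (0 <= eta2)%E.
  apply: limf_esup_ge0 => [|t]; last by rewrite lee_fin enorm_ge0.
  exact: filter_not_empty.
case eta2E : eta2 => [s| |]; last 2 first.
- by move=> _; exact: leey.
- by rewrite leNgt ltNyr.
rewrite lee_fin => s0; apply/lee_addgt0Pr => d d0; rewrite -EFinD.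
apply: limsup_pinfty_le.
(* Half of the slack [d] bounds [E2]; the other half is left for the transient. *)
have [M [_ E2M]] : \forall t \near +oo, enorm (E2 t) < s + d / 2.
  by apply: limsup_pinfty_lt; rewrite -/eta2 eta2E lte_fin; lra.
(* Beyond [M] for the bound on [E2], and positive so that derivatives are two-sided. *)
pose a := Num.max M 0 + 1.
have aM : M < a by rewrite ltr_pwDr// le_max lexx.
have a0 : 0 < a by rewrite ltr_pwDr// le_max lexx orbT.
have : \forall t \near +oo, enorm (e t) <= s + d.
  apply: (enorm_ultimate_bound e E2 a (s + d / 2)); [lra|lra|..].
  - by move=> t at_; apply: e_cont; lra.
  - by move=> t at_; apply/ltW/E2M; lra.
  - move=> b; apply: (@sub_finite_set _ _
      (* Bad times of [e] are those of [r] moved back by the lookahead [T]. *)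
      ((fun t => t - T) @` [set t | 0 < t < b + T /\ ~ derivable r t 1])).
      move=> t /= [/andP[at_ tb] nt]; exists (t + T); last by rewrite addrK.
      split; first by apply/andP; split; lra.
      by move=> rt; apply: nt; apply: e' => //; lra.
    exact/finite_image/pr.
(* The error at time [t] is [e (t - T)], hence the shifted threshold. *)
move=> [N [_ eN]]; exists (N + T); split; first exact: num_real.
move=> t Nt; have := eN (t - T); rewrite /e subrK; apply.
by rewrite ltrBrDr.
Qed.
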